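(* Let $\mu\equiv1$ and let $k\ge1$ be even. Then $K_{\mu,k}(\omega)<0$ for all $\omega\in\mathbb R$ if and only if $k\in(\sqrt2,2\sqrt2)+2\sqrt2\,\mathbb Z$.
   Context: For $j\ge1$, $\lambda_j=(j\pi)^2$, $\varphi_j(x)=\sqrt2\sin(j\pi x)$; $\langle f,g\rangle=\int_0^1fg$. With $\lambda_{n,k}:=\lambda_n-\frac{\lambda_k}2$, for $\omega\in\mathbb R$, $$K_{\mu,k}(\omega)=\sum_{n\ge1}\frac{\langle\mu,\varphi_n\rangle}{n}\left(\frac{\langle\mu,\varphi_{n+k}\rangle}{n+k}+\frac{\langle\mu,\varphi_{|n-k|}\rangle}{|n-k|}\mathbb 1_{n\ne k}\right)\frac{\lambda_{n,k}}{\lambda_{n,k}^2+\omega^2}.$$ *)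

(* Defs.v *)
From Stdlib Require Import Reals ZArith Arith.
From Coquelicot Require Import Coquelicot.
Open Scope R_scope.

Definition lambda (j : nat) : R := (INR j * PI) ^ 2.

Definition phi (j : nat) (x : R) : R := sqrt 2 * sin (INR j * PI * x).

(* Riemann integral: equals the L^2(0,1) inner product whenever f and g are
   continuous on [0,1]. *)
Definition inner (f g : R -> R) : R := RInt (fun x => f x * g x) 0 1.

Definition lambda2 (n k : nat) : R := lambda n - lambda k / 2.

Definition absdiff (n k : nat) : nat := Z.abs_nat (Z.of_nat n - Z.of_nat k).

Definition indic_neq (n k : nat) : R := if Nat.eq_dec n k then 0 else 1.

(* For n = k the quotient by [INR (absdiff n k)] = 0 is a real number of
   unspecified value, and the factor [indic_neq n k] = 0 cancels it. *)
Definition Kterm (mu : R -> R) (k : nat) (omega : R) (n : nat) : R :=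
  inner mu (phi n) / INR n *
  (inner mu (phi (n + k)) / INR (n + k)
   + inner mu (phi (absdiff n k)) / INR (absdiff n k) * indic_neq n k) *
  (lambda2 n k / (lambda2 n k ^ 2 + omega ^ 2)).

(* [Series] starts at index 0, the sum over n >= 1 is shifted accordingly. *)
Definition K (mu : R -> R) (k : nat) (omega : R) : R :=
  Series (fun i => Kterm mu k omega (S i)).

(* Main.v *)
Require Import Defs.
From Stdlib Require Import Reals ZArith Arith.
From Coquelicot Require Import Coquelicot.
From Stdlib Require Import Lra Lia.
Open Scope R_scope.

(** For the constant function 1 and even k only odd n contribute, and with
    x = n^2, a = k^2 / 2, w = omega / PI^2 the n-th term is 16 / PI^4 times the
    real part of (x + 2 a) / (x (x - 2 a)^2 (x - z)), z = a + i w.  In the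
    partial-fraction expansion the contributions of the poles 0 and 2 a = k^2
    cancel out in the sum over odd n, and there remains, writing z = zeta^2,

      K(omega) = 4 / (PI^3 |z|^4) Re ((z + 2 a) zeta tan (PI zeta / 2))

    ([K_from_pole_sums], [K_eq_pos_mult_sign_factor]).  At omega = 0 one has
    zeta = b = k / sqrt 2, and the sign is that of tan (PI b / 2), hence of
    sin (PI b); so negativity for all omega forces b to lie in (1, 2) + 2 Z,
    which is the stated condition ([sin_neg_iff]).  Conversely, if
    sin (PI b) < 0, elementary bounds on sin and sinh show that the real part
    stays negative for every omega ([sign_factor_neg]).

    The series needed for this, the sums over odd n of 1 / n^2,
    1 / (n^2 - k^2), (n^2 + k^2) / (n^2 - k^2)^2 and 1 / (n^2 - zeta^2), all come
    from one principle: for continuous u differentiable at 0, the integrals of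
    u(x) cos (n x) over [0, PI / 2], n odd, sum to PI u(0) / 4
    ([is_series_cos_coef]).  If moreover u solves a linear differential equation
    with constant coefficients and u(PI / 2) = 0, integration by parts evaluates
    these integrals as rational functions of n
    ([cos_coef_second_derivative]).  Complex quantities are carried as pairs of
    real and imaginary parts. *)

(** * The Riemann-Lebesgue lemma for continuous functions *)

Lemma continuous_sin_scaled (m x : R) : continuous (fun x => sin (m * x)) x.
Proof. apply (ex_derive_continuous (V := R_NormedModule)). auto_derive. exact I. Qed.

Lemma continuous_cos_scaled (m x : R) : continuous (fun x => cos (m * x)) x.
Proof. apply (ex_derive_continuous (V := R_NormedModule)). auto_derive. exact I. Qed.

Lemma ex_RInt_continuous_on (f : R -> R) (a b c d : R) :
  a <= c -> c <= d -> d <= b -> (forall x, a <= x <= b -> continuous f x) ->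
  ex_RInt f c d.
Proof.
  intros h1 h2 h3 hf. apply (ex_RInt_continuous (V := R_CompleteNormedModule)).
  intros x. rewrite Rmin_left, Rmax_right by lra. intros hx. apply hf. lra.
Qed.

(** Translating by the half period PI / m changes the sign of sin (m x), so
    the integral is minus its own translate up to two end pieces of length
    PI / m.  Averaging the two expressions replaces [q] by a difference that
    uniform continuity makes small. *)
Lemma RInt_half_period_shift (q : R -> R) (b m : R) :
  0 <= b -> PI <= m ->
  (forall x, 0 <= x <= b + 1 -> continuous q x) ->
  2 * RInt (fun x => q x * sin (m * x)) 0 b =
  RInt (fun x => (q x - q (x + PI / m)) * sin (m * x)) 0 b
  + RInt (fun x => q x * sin (m * x)) 0 (PI / m)
  - RInt (fun x => q x * sin (m * x)) b (b + PI / m).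
Proof.
  intros hb hm hq.
  pose proof PI_RGT_0 as hpi.
  assert (hd : 0 < PI / m) by (apply Rdiv_lt_0_compat; lra).
  assert (hd1 : PI / m <= 1).
  { apply (Rmult_le_reg_r m); [lra|]. unfold Rdiv.
    rewrite Rmult_assoc, Rinv_l by lra. lra. }
  set (d := PI / m) in *.
  set (f := fun x => q x * sin (m * x)).
  assert (hf : forall x, 0 <= x <= b + 1 -> continuous f x).
  { intros x hx. apply (continuous_mult (K := R_AbsRing)); [now apply hq|].
    apply continuous_sin_scaled. }
  assert (hsplit : RInt f 0 b + RInt f b (b + d) = RInt f 0 d + RInt f d (b + d)).
  { transitivity (RInt f 0 (b + d)).
    - apply (RInt_Chasles (V := R_CompleteNormedModule) f);
        apply (ex_RInt_continuous_on _ 0 (b + 1)); auto; lra.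
    - symmetry. apply (RInt_Chasles (V := R_CompleteNormedModule) f);
        apply (ex_RInt_continuous_on _ 0 (b + 1)); auto; lra. }
  assert (hg : forall x, 0 <= x <= b -> continuous (fun x => q (x + d) * sin (m * x)) x).
  { intros x hx. apply (continuous_mult (K := R_AbsRing)).
    - apply (continuous_comp (fun x => x + d) q).
      + apply (ex_derive_continuous (V := R_NormedModule)). auto_derive. exact I.
      + apply hq. lra.
    - apply continuous_sin_scaled. }
  assert (hshift : RInt f d (b + d) = - RInt (fun x => q (x + d) * sin (m * x)) 0 b).
  { replace (RInt f d (b + d)) with (RInt f (1 * 0 + d) (1 * b + d)) by (f_equal; ring).
    rewrite <- (RInt_comp_lin (V := R_CompleteNormedModule) f 1 d 0 b).
    - rewrite <- (RInt_opp (V := R_CompleteNormedModule)).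
      + apply RInt_ext. intros x _. unfold f. unfold scal, opp; simpl. unfold mult; simpl.
        replace (m * (1 * x + d)) with (m * x + PI) by (unfold d; field; lra).
        rewrite neg_sin. replace (1 * x + d) with (x + d) by ring. ring.
      + apply (ex_RInt_continuous_on _ 0 b); auto; lra.
    - apply (ex_RInt_continuous_on _ 0 (b + 1)); auto; lra. }
  assert (hdiff : RInt (fun x => (q x - q (x + d)) * sin (m * x)) 0 b =
    RInt f 0 b - RInt (fun x => q (x + d) * sin (m * x)) 0 b).
  { rewrite <- (RInt_minus (V := R_CompleteNormedModule)).
    - apply RInt_ext. intros x _. unfold f, minus, plus, opp; simpl. ring.
    - apply (ex_RInt_continuous_on _ 0 (b + 1)); auto; lra.
    - apply (ex_RInt_continuous_on _ 0 b); auto; lra. }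
  fold f. lra.
Qed.

(** Continuity is asked a little beyond [b] because the half-period shift
    evaluates [q] at points up to [b + PI / N]. *)
Lemma riemann_lebesgue (q : R -> R) (b : R) :
  0 <= b -> (forall x, 0 <= x <= b + 1 -> continuous q x) ->
  is_lim_seq (fun N => RInt (fun x => q x * sin (INR N * x)) 0 b) 0.
Proof.
  intros hb hq.
  assert (hqpt : forall x, 0 <= x <= b + 1 -> continuity_pt q x).
  { intros x hx. apply continuity_pt_filterlim. now apply hq. }
  destruct (continuity_ab_maj (fun x => Rabs (q x)) 0 (b + 1)) as [xM [hM _]]; [lra| |].
  { intros x hx. apply (continuity_pt_comp q Rabs); [now apply hqpt|].
    apply Rcontinuity_abs. }
  set (M := Rabs (q xM)) in hM.
  assert (hM0 : 0 <= M) by apply Rabs_pos.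
  apply is_lim_seq_spec. intros eps.
  assert (he : 0 < eps / (b + 1)) by (apply Rdiv_lt_0_compat; [apply cond_pos|lra]).
  destruct (Heine_cor2 hqpt (mkposreal _ he)) as [delta hdelta].
  simpl in hdelta.
  pose proof PI_RGT_0 as hpi.
  pose proof (cond_pos delta) as hdpos. pose proof (cond_pos eps) as hepos.
  (* The three summands ensure PI / N <= 1, PI / N < delta and a bound eps on
     the two end pieces. *)
  destruct (INR_archimed 1 (PI + PI / delta + 2 * PI * M / eps)) as [N0 hN0]; [lra|].
  exists (S N0). intros N hN.
  assert (h1 : 0 < PI / delta) by (apply Rdiv_lt_0_compat; lra).
  assert (h2 : 0 <= 2 * PI * M / eps).
  { apply Rmult_le_pos; [|left; now apply Rinv_0_lt_compat]. nra. }
  assert (hNR : PI + PI / delta + 2 * PI * M / eps < INR N).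
  { apply (Rlt_trans _ (INR N0)); [lra|]. apply lt_INR. lia. }
  set (m := INR N) in *.
  assert (hd : 0 < PI / m) by (apply Rdiv_lt_0_compat; lra).
  assert (hd1 : PI / m <= 1).
  { apply (Rmult_le_reg_r m); [lra|]. unfold Rdiv.
    rewrite Rmult_assoc, Rinv_l by lra. lra. }
  assert (hdm : PI / m * m = PI) by (field; lra).
  assert (hddelta : PI / m < delta).
  { apply (Rmult_lt_reg_r m); [lra|]. rewrite hdm.
    assert (PI / delta * delta = PI) by (field; lra). nra. }
  assert (hdM : 2 * (PI / m * M) <= eps).
  { apply (Rmult_le_reg_r m); [lra|].
    replace (2 * (PI / m * M) * m) with (2 * M * (PI / m * m)) by ring. rewrite hdm.
    assert (2 * PI * M / eps * eps = 2 * PI * M) by (field; lra). nra. }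
  assert (hcf : forall x, 0 <= x <= b + 1 -> continuous (fun x => q x * sin (m * x)) x).
  { intros x hx. apply (continuous_mult (K := R_AbsRing)); [now apply hq|].
    apply continuous_sin_scaled. }
  assert (hsin : forall x, Rabs (sin (m * x)) <= 1).
  { intros x. apply Rabs_le. pose proof (SIN_bound (m * x)). lra. }
  pose proof (RInt_half_period_shift q b m hb ltac:(lra) hq) as hI.
  assert (b0 : Rabs (RInt (fun x => (q x - q (x + PI / m)) * sin (m * x)) 0 b)
               <= (b - 0) * (eps / (b + 1))).
  { apply abs_RInt_le_const; [lra| |].
    - apply (ex_RInt_continuous_on _ 0 b); try lra. intros x hx.
      apply (continuous_mult (K := R_AbsRing)); [|apply continuous_sin_scaled].
      apply (continuous_minus (V := R_NormedModule) q); [apply hq; lra|].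
      apply (continuous_comp (fun x => x + PI / m) q).
      + apply (ex_derive_continuous (V := R_NormedModule)). auto_derive. exact I.
      + apply hq. lra.
    - intros x hx. rewrite Rabs_mult.
      assert (Rabs (q x - q (x + PI / m)) < eps / (b + 1)).
      { apply hdelta; try lra. rewrite Rabs_minus_sym.
        replace (x + PI / m - x) with (PI / m) by ring. rewrite Rabs_right; lra. }
      pose proof (hsin x). pose proof (Rabs_pos (q x - q (x + PI / m))).
      pose proof (Rabs_pos (sin (m * x))). nra. }
  assert (bnd : forall c, 0 <= c -> c <= b -> 
    Rabs (RInt (fun x => q x * sin (m * x)) c (c + PI / m)) <= (c + PI / m - c) * M).
  { intros c hc hcb. apply abs_RInt_le_const; [lra| |].
    - apply (ex_RInt_continuous_on _ 0 (b + 1)); auto; lra.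
    - intros x hx. rewrite Rabs_mult. specialize (hM x ltac:(lra)).
      pose proof (hsin x). pose proof (Rabs_pos (q x)).
      pose proof (Rabs_pos (sin (m * x))). nra. }
  pose proof (bnd 0 ltac:(lra) ltac:(lra)) as b1. rewrite Rplus_0_l in b1.
  pose proof (bnd b ltac:(lra) ltac:(lra)) as b2.
  apply Rabs_le_between in b0. apply Rabs_le_between in b1. apply Rabs_le_between in b2.
  assert (b * (eps / (b + 1)) < eps).
  { apply (Rmult_lt_reg_r (b + 1)); [lra|].
    replace (b * (eps / (b + 1)) * (b + 1)) with (b * eps) by (field; lra). nra. }
  rewrite Rminus_0_r. apply Rabs_lt_between. lra.
Qed.

(** * Sums of odd cosine coefficients *)

(** The difference quotient at 0, with the removable singularity filled in by
    [f0], meant to be the derivative of [f] at 0. *)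
Definition slope (f : R -> R) (f0 x : R) : R :=
  if Req_EM_T x 0 then f0 else (f x - f 0) / x.

Lemma slope_spec (f : R -> R) (f0 x : R) : f x = f 0 + slope f f0 x * x.
Proof.
  unfold slope. destruct (Req_EM_T x 0) as [->|h]; [ring|]. field. exact h.
Qed.

Lemma slope_continuous (f : R -> R) (f0 x : R) :
  is_derive f 0 f0 -> continuous f x -> continuous (slope f f0) x.
Proof.
  intros hf hc. destruct (Req_dec x 0) as [->|hx].
  - apply is_derive_Reals in hf. apply continuity_pt_filterlim.
    apply continuity_pt_locally. intros eps.
    destruct (hf eps (cond_pos eps)) as [d hd].
    exists d. intros y hy. unfold ball in hy; simpl in hy.
    unfold AbsRing_ball, abs, minus, plus, opp in hy; simpl in hy.
    unfold slope. destruct (Req_EM_T 0 0) as [_|]; [|lra].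
    destruct (Req_EM_T y 0) as [h|h].
    + rewrite Rminus_diag, Rabs_R0. apply cond_pos.
    + specialize (hd y h). rewrite Rplus_0_l in hd. apply hd.
      replace y with (y + - 0) by ring. exact hy.
  - apply (continuous_ext_loc _ (fun y => (f y - f 0) / y)).
    + assert (hp : 0 < Rabs x) by now apply Rabs_pos_lt.
      exists (mkposreal _ hp). intros y hy. unfold ball in hy; simpl in hy.
      unfold AbsRing_ball, abs, minus, plus, opp in hy; simpl in hy.
      unfold slope. destruct (Req_EM_T y 0) as [->|]; [|reflexivity].
      rewrite Rplus_0_l, Rabs_Ropp in hy. lra.
    + apply (continuous_mult (K := R_AbsRing)).
      * apply (continuous_minus (V := R_NormedModule) f); [exact hc|apply continuous_const].
      * apply (ex_derive_continuous (V := R_NormedModule)). auto_derive. exact hx.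
Qed.

(** Only half of the period is used: the functions to which this is applied
    are antisymmetric about PI / 2, and so are the odd cosines. *)
Definition cos_coef (u : R -> R) (n : R) : R := RInt (fun x => u x * cos (n * x)) 0 (PI / 2).

Definition odd_freq (j : nat) : R := 2 * INR j + 1.

(** The Dirichlet kernel of the odd frequencies. *)
Lemma dirichlet_sum (N : nat) (x : R) :
  sum_n (fun j => cos (odd_freq j * x)) N * sin x = sin (INR (2 * S N) * x) / 2.
Proof.
  induction N as [|N IH].
  - rewrite sum_O. unfold odd_freq. simpl. replace ((1 + 1) * x) with (2 * x) by ring.
    rewrite sin_2a.
    replace ((2 * 0 + 1) * x) with x by ring. field.
  - rewrite sum_Sn. unfold plus; simpl plus. rewrite Rmult_plus_distr_r, IH.
    unfold odd_freq. rewrite !mult_INR, !S_INR. simpl (INR 0).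
    set (p := (2 * (INR N + 1) + 1) * x).
    replace ((0 + 1 + 1) * (INR N + 1) * x) with (p - x) by (unfold p; ring).
    replace ((0 + 1 + 1) * (INR N + 1 + 1) * x) with (p + x) by (unfold p; ring).
    rewrite sin_minus, sin_plus. field.
Qed.

Lemma cos_odd_freq_half_pi (j : nat) : cos (odd_freq j * (PI / 2)) = 0.
Proof.
  apply cos_eq_0_1. exists (Z.of_nat j). rewrite <- INR_IZR_INZ.
  unfold odd_freq. field.
Qed.

Lemma ex_RInt_cos_mult (u : R -> R) (n : R) :
  (forall x, continuous u x) -> ex_RInt (fun x => u x * cos (n * x)) 0 (PI / 2).
Proof.
  intros hu. apply (ex_RInt_continuous (V := R_CompleteNormedModule)).
  intros x _. apply (continuous_mult (K := R_AbsRing)); [apply hu|].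
  apply continuous_cos_scaled.
Qed.

Lemma cos_coef_lin (u v : R -> R) (c d n : R) :
  (forall x, continuous u x) -> (forall x, continuous v x) ->
  cos_coef (fun x => c * u x + d * v x) n = c * cos_coef u n + d * cos_coef v n.
Proof.
  intros hu hv. unfold cos_coef.
  pose proof (RInt_correct (V := R_CompleteNormedModule) _ _ _ (ex_RInt_cos_mult u n hu)) as iu.
  pose proof (RInt_correct (V := R_CompleteNormedModule) _ _ _ (ex_RInt_cos_mult v n hv)) as iv.
  apply is_RInt_unique.
  apply (is_RInt_scal _ _ _ c) in iu. apply (is_RInt_scal _ _ _ d) in iv.
  refine (is_RInt_ext _ _ _ _ _ _ (is_RInt_plus _ _ _ _ _ _ iu iv)).
  intros x _. unfold plus, scal; simpl. unfold mult; simpl. ring.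
Qed.

(** Two integrations by parts.  At PI / 2 the boundary terms vanish because
    both [u] and cos (n x), n odd, do. It turns a differential equation for
    [u] into an algebraic equation for its coefficients. *)
Lemma cos_coef_second_derivative (u u1 u2 : R -> R) (j : nat) :
  (forall x, is_derive u x (u1 x)) -> (forall x, is_derive u1 x (u2 x)) ->
  (forall x, continuous u2 x) -> u (PI / 2) = 0 ->
  cos_coef u2 (odd_freq j) + odd_freq j ^ 2 * cos_coef u (odd_freq j) = - u1 0.
Proof.
  intros h1 h2 hc hu. set (n := odd_freq j).
  assert (cu : forall x, continuous u x).
  { intros x. apply (ex_derive_continuous (V := R_NormedModule)). now exists (u1 x). }
  transitivity (cos_coef (fun x => 1 * u2 x + n ^ 2 * u x) n).
  { rewrite cos_coef_lin by assumption. ring. }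
  unfold cos_coef. apply is_RInt_unique.
  replace (- u1 0) with
    (minus (u1 (PI / 2) * cos (n * (PI / 2)) + n * (u (PI / 2) * sin (n * (PI / 2))))
           (u1 0 * cos (n * 0) + n * (u 0 * sin (n * 0)))).
  2:{ unfold n at 1. rewrite cos_odd_freq_half_pi, hu, !Rmult_0_r, cos_0, sin_0.
      unfold minus, plus, opp; simpl. ring. }
  apply (is_RInt_derive (fun x => u1 x * cos (n * x) + n * (u x * sin (n * x)))).
  - intros x _. auto_derive.
    + split; [now exists (u2 x)|]. split; [now exists (u1 x)|exact I].
    + assert (e1 : Derive (fun x : R => u x) x = u1 x) by apply is_derive_unique, h1.
      assert (e2 : Derive (fun x : R => u1 x) x = u2 x) by apply is_derive_unique, h2.
      rewrite e1, e2. ring.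
  - intros x _. apply (continuous_mult (K := R_AbsRing)); [|apply continuous_cos_scaled].
    apply (continuous_plus (V := R_NormedModule)).
    + apply (continuous_mult (K := R_AbsRing)); [apply continuous_const|apply hc].
    + apply (continuous_mult (K := R_AbsRing)); [apply continuous_const|apply cu].
Qed.

Lemma is_RInt_dirichlet_sum (u : R -> R) (N : nat) : (forall x, continuous u x) ->
  is_RInt (fun x => u x * sum_n (fun j => cos (odd_freq j * x)) N) 0 (PI / 2)
    (sum_n (fun j => cos_coef u (odd_freq j)) N).
Proof.
  intros hu. induction N as [|N IH].
  - rewrite sum_O. apply (is_RInt_ext (fun x => u x * cos (odd_freq 0 * x))).
    + intros x _. now rewrite sum_O.
    + apply (RInt_correct (V := R_CompleteNormedModule)). now apply ex_RInt_cos_mult.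
  - rewrite sum_Sn.
    pose proof (RInt_correct (V := R_CompleteNormedModule) _ _ _ 
       (ex_RInt_cos_mult u (odd_freq (S N)) hu)) as iu.
    refine (is_RInt_ext _ _ _ _ _ _ (is_RInt_plus _ _ _ _ _ _ IH iu)).
    intros x _. rewrite sum_Sn. unfold plus; simpl. ring.
Qed.

Lemma cos_coef_cos (j : nat) : cos_coef cos (odd_freq j) = if Nat.eq_dec j 0 then PI / 4 else 0.
Proof.
  destruct (Nat.eq_dec j 0) as [->|hj].
  - unfold cos_coef. apply is_RInt_unique.
    replace (PI / 4) with (minus (PI / 2 / 2 + sin (PI / 2) * cos (PI / 2) / 2)
                                 (0 / 2 + sin 0 * cos 0 / 2)).
    2:{ rewrite cos_PI2, sin_0. unfold minus, plus, opp; simpl. field. }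
    apply (is_RInt_derive (fun x => x / 2 + sin x * cos x / 2)).
    + intros x _. auto_derive; [exact I|].
      unfold odd_freq. simpl. replace ((2 * 0 + 1) * x) with x by ring.
      pose proof (sin2_cos2 x). unfold Rsqr in *. lra.
    + intros x _. apply (continuous_mult (K := R_AbsRing)).
      * apply continuous_cos.
      * apply continuous_cos_scaled.
  - assert (h : cos_coef (fun x => - cos x) (odd_freq j)
                + odd_freq j ^ 2 * cos_coef cos (odd_freq j)
                = - - sin 0).
    { apply (cos_coef_second_derivative cos (fun x => - sin x)).
      - intros x. auto_derive; [exact I|ring].
      - intros x. auto_derive; [exact I|ring].
      - intros x. apply (continuous_opp (V := R_NormedModule)). apply continuous_cos.
      - apply cos_PI2. }
    rewrite sin_0 in h.
    assert (h' : cos_coef (fun x => - cos x) (odd_freq j) = - cos_coef cos (odd_freq j)).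
    { transitivity (cos_coef (fun x => (-1) * cos x + 0 * cos x) (odd_freq j)).
      - apply RInt_ext. intros x _. simpl. ring.
      - rewrite cos_coef_lin by (intros; apply continuous_cos). ring. }
    rewrite h' in h.
    assert (h2 : (odd_freq j ^ 2 - 1) * cos_coef cos (odd_freq j) = 0) by lra.
    assert (1 <= INR j) by (apply (le_INR 1); lia).
    apply Rmult_integral in h2. destruct h2 as [h2|h2]; [|exact h2].
    unfold odd_freq in h2. nra.
Qed.

(** The cosine is the test function with which the value of a function at 0 is
    split off in [is_series_cos_coef]: only its first coefficient survives. *)
Lemma sum_cos_coef_cos (N : nat) : sum_n (fun j => cos_coef cos (odd_freq j)) N = PI / 4.
Proof.
  induction N as [|N IH].
  - rewrite sum_O. apply cos_coef_cos.
  - rewrite sum_Sn, IH, cos_coef_cos. unfold plus; simpl. ring.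
Qed.

Lemma sin_pos_past_half_pi (x : R) : 0 < x <= PI / 2 + 1 -> 0 < sin x.
Proof.
  intros hx. apply sin_gt_0; [lra|]. pose proof PI2_3_2. unfold PI2 in *. lra.
Qed.

Lemma sum_n_lin (a b : nat -> R) (c d : R) (N : nat) :
  sum_n (fun j => c * a j + d * b j) N = c * sum_n a N + d * sum_n b N.
Proof.
  induction N as [|N IH].
  - now rewrite !sum_O.
  - rewrite !sum_Sn, IH. unfold plus; simpl. ring.
Qed.

(** Fourier inversion at 0.  After subtracting u(0) cos x, whose coefficients
    sum to u(0) PI / 4, the remainder [v] vanishes at 0 and v / sin extends
    continuously to 0.  Against the Dirichlet kernel sin (2 N x) / (2 sin x)
    this leaves the integral of a continuous function times sin (2 N x), which
    tends to 0. *)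
Lemma is_series_cos_coef (u : R -> R) (u1 : R) :
  (forall x, continuous u x) -> is_derive u 0 u1 ->
  is_series (fun j => cos_coef u (odd_freq j)) (PI / 4 * u 0).
Proof.
  intros hu hd.
  set (v := fun x => u x - u 0 * cos x).
  set (q := fun x => slope v u1 x / slope sin 1 x).
  assert (hv0 : v 0 = 0) by (unfold v; rewrite cos_0; ring).
  assert (hvd : is_derive v 0 u1).
  { unfold v. auto_derive; [now exists u1|].
    assert (e : Derive (fun x : R => u x) 0 = u1) by apply is_derive_unique, hd.
    rewrite e, sin_0. ring. }
  assert (hsd : is_derive sin 0 1).
  { auto_derive; [exact I|]. rewrite cos_0. ring. }
  assert (hvc : forall x, continuous v x).
  { intros x. apply (continuous_minus (V := R_NormedModule) u); [apply hu|].
    apply (continuous_mult (K := R_AbsRing)); [apply continuous_const|apply continuous_cos]. }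
  assert (hsl : forall x, 0 <= x <= PI / 2 + 1 -> slope sin 1 x <> 0).
  { intros x hx. unfold slope. destruct (Req_EM_T x 0) as [_|h]; [lra|].
    rewrite sin_0, Rminus_0_r. pose proof (sin_pos_past_half_pi x ltac:(lra)).
    apply Rgt_not_eq. apply Rdiv_lt_0_compat; lra. }
  assert (hq : forall x, 0 <= x <= PI / 2 + 1 -> continuous q x).
  { intros x hx. apply (continuous_mult (K := R_AbsRing)).
    - now apply slope_continuous.
    - apply continuous_Rinv_comp; [|now apply hsl].
      apply slope_continuous; [exact hsd|apply continuous_sin]. }
  assert (hvq : forall x, 0 <= x <= PI / 2 + 1 -> v x = q x * sin x).
  { intros x hx. rewrite (slope_spec v u1), (slope_spec sin 1 x), hv0, sin_0.
    unfold q. field. now apply hsl. }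
  pose proof PI_RGT_0 as hpi.
  assert (hsum : forall N, sum_n (fun j => cos_coef u (odd_freq j)) N =
    u 0 * (PI / 4) + / 2 * RInt (fun x => q x * sin (INR (2 * S N) * x)) 0 (PI / 2)).
  { intros N.
    transitivity (sum_n (fun j => u 0 * cos_coef cos (odd_freq j) + 1 * cos_coef v (odd_freq j)) N).
    { apply sum_n_ext. intros j. rewrite <- cos_coef_lin.
      - apply RInt_ext. intros x _. simpl. unfold v. ring.
      - apply continuous_cos.
      - exact hvc. }
    rewrite sum_n_lin, sum_cos_coef_cos, Rmult_1_l. f_equal.
    rewrite <- (is_RInt_unique _ _ _ _ (is_RInt_dirichlet_sum v N hvc)).
    assert (hex : ex_RInt (fun x => q x * sin (INR (2 * S N) * x)) 0 (PI / 2)).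
    { apply (ex_RInt_continuous_on _ 0 (PI / 2)); try lra. intros x hx.
      apply (continuous_mult (K := R_AbsRing)); [apply hq; lra|].
      apply continuous_sin_scaled. }
    rewrite <- (RInt_scal (V := R_CompleteNormedModule) _ _ _ (/ 2)) by exact hex.
    apply RInt_ext. intros x. rewrite Rmin_left, Rmax_right by lra. intros hx.
    rewrite hvq by lra. unfold scal; simpl. unfold mult; simpl.
    pose proof (dirichlet_sum N x) as hD. 
    rewrite Rmult_assoc, (Rmult_comm (sin x)), hD. simpl. field. }
  change (is_lim_seq (sum_n (fun j => cos_coef u (odd_freq j))) (PI / 4 * u 0)).
  apply (is_lim_seq_ext _ _ _ (fun N => eq_sym (hsum N))).
  replace (Finite (PI / 4 * u 0)) with (Finite (u 0 * (PI / 4) + / 2 * 0))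
    by (f_equal; ring).
  apply is_lim_seq_plus'; [apply is_lim_seq_const|].
  apply (is_lim_seq_scal_l _ (/ 2) 0).
  pose proof (riemann_lebesgue q (PI / 2) ltac:(lra) hq) as hRL.
  apply (is_lim_seq_subseq _ _ (fun N => (2 * S N)%nat)) in hRL; [exact hRL|].
  apply eventually_subseq. intros n. lia.
Qed.

(** * The partial-fraction series *)

Lemma odd_freq_pos (j : nat) : 1 <= odd_freq j.
Proof. unfold odd_freq. pose proof (pos_INR j). lra. Qed.

Lemma continuous_of_derive (u u1 : R -> R) :
  (forall x, is_derive u x (u1 x)) -> forall x, continuous u x.
Proof.
  intros h x. apply (ex_derive_continuous (V := R_NormedModule)). now exists (u1 x).
Qed.

(** The differential equations used below are linear with constant
    coefficients and possibly coupled, u'' = c u + d v. *)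
Lemma cos_coef_system (u u1 v : R -> R) (c d : R) (j : nat) :
  (forall x, is_derive u x (u1 x)) ->
  (forall x, is_derive u1 x (c * u x + d * v x)) ->
  (forall x, continuous v x) -> u (PI / 2) = 0 ->
  (odd_freq j ^ 2 + c) * cos_coef u (odd_freq j) + d * cos_coef v (odd_freq j) = - u1 0.
Proof.
  intros h1 h2 hv hu.
  pose proof (continuous_of_derive _ _ h1) as hc.
  rewrite <- (cos_coef_second_derivative u u1 (fun x => c * u x + d * v x) j); try assumption.
  - rewrite cos_coef_lin by assumption. ring.
  - intros x. apply (continuous_plus (V := R_NormedModule));
    (apply (continuous_mult (K := R_AbsRing)); [apply continuous_const|auto]).
Qed.

(** Source function: PI / 2 - x. *)
Lemma is_series_inv_odd_sq :
  is_series (fun j => / odd_freq j ^ 2) (PI ^ 2 / 8).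
Proof.
  set (u := fun x => PI / 2 - x).
  assert (h1 : forall x, is_derive u x (-1)).
  { intros x. unfold u. auto_derive; [exact I|ring]. }
  pose proof (continuous_of_derive _ _ h1) as hc.
  replace (PI ^ 2 / 8) with (PI / 4 * u 0) by (unfold u; field).
  apply (is_series_ext (fun j => cos_coef u (odd_freq j))).
  - intros j. pose proof (odd_freq_pos j).
    assert (h : (odd_freq j ^ 2 + 0) * cos_coef u (odd_freq j)
                + 0 * cos_coef u (odd_freq j) = - -1).
    { apply (cos_coef_system u (fun _ => -1)); auto.
      - intros x. replace (0 * u x + 0 * u x) with 0 by ring.
        apply (is_derive_const (V := R_NormedModule)).
      - unfold u. ring. }
    apply (Rmult_eq_reg_l (odd_freq j ^ 2)); [|nra].
    rewrite Rinv_r by nra. lra.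
  - now apply (is_series_cos_coef u (-1)).
Qed.

Lemma sin_even_half_pi (k : nat) : Nat.Even k -> sin (INR k * (PI / 2)) = 0.
Proof.
  intros [m ->]. apply sin_eq_0_1. exists (Z.of_nat m). rewrite <- INR_IZR_INZ.
  rewrite mult_INR. simpl. field.
Qed.

(** The two squares differ modulo 2. *)
Lemma odd_freq_sq_neq_even_sq (k j : nat) : Nat.Even k -> odd_freq j ^ 2 - INR k ^ 2 <> 0.
Proof.
  intros [m ->] h. unfold odd_freq in h. rewrite mult_INR, !INR_IZR_INZ in h.
  set (i := Z.of_nat j) in h. set (p := Z.of_nat m) in h.
  assert (hz : IZR (4 * (i * i + i - p * p)) = IZR (-1)).
  { rewrite mult_IZR, minus_IZR, plus_IZR, !mult_IZR. simpl in h |- *. lra. }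
  apply eq_IZR in hz. lia.
Qed.

Lemma cos_coef_sin_even (k j : nat) : Nat.Even k ->
  cos_coef (fun x => sin (INR k * x)) (odd_freq j) = - INR k / (odd_freq j ^ 2 - INR k ^ 2).
Proof.
  intros hk. pose proof (odd_freq_sq_neq_even_sq k j hk).
  set (u := fun x => sin (INR k * x)).
  assert (h : (odd_freq j ^ 2 + - INR k ^ 2) * cos_coef u (odd_freq j) + 0 * cos_coef u (odd_freq j)
     = - (INR k * cos (INR k * 0))).
  { apply (cos_coef_system u (fun x => INR k * cos (INR k * x))).
    - intros x. unfold u. auto_derive; [exact I|ring].
    - intros x. unfold u. auto_derive; [exact I|ring].
    - intros x. apply continuous_sin_scaled.
    - now apply sin_even_half_pi. }
  rewrite Rmult_0_r, cos_0 in h.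
  apply (Rmult_eq_reg_l (odd_freq j ^ 2 - INR k ^ 2)); [|assumption].
  transitivity (- INR k); [lra|field; assumption].
Qed.

(** Source function: sin (k x), which vanishes at 0 and, for even [k], at
    PI / 2. *)
Lemma is_series_even_pole (k : nat) : Nat.Even k ->
  (1 <= k)%nat ->
  is_series (fun j => / (odd_freq j ^ 2 - INR k ^ 2)) 0.
Proof.
  intros hk hk1. set (u := fun x => sin (INR k * x)).
  apply le_INR in hk1. simpl in hk1.
  replace 0 with (scal (- / INR k) (PI / 4 * u 0)).
  2:{ unfold u. rewrite Rmult_0_r, sin_0. unfold scal; simpl. unfold mult; simpl. ring. }
  apply (is_series_ext (fun j => scal (- / INR k) (cos_coef u (odd_freq j)))).
  - intros j. unfold u. rewrite cos_coef_sin_even by assumption.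
    pose proof (odd_freq_sq_neq_even_sq k j hk).
    unfold scal; simpl. unfold mult; simpl. field.
    split; [intros h; apply H; lra|lra].
  - apply (is_series_scal (V := R_NormedModule)). apply (is_series_cos_coef u (INR k)).
    + intros x. apply continuous_sin_scaled.
    + unfold u. auto_derive; [exact I|]. rewrite Rmult_0_r, cos_0. ring.
Qed.

(** Source function: (PI / 2 - x) cos (k x), whose second derivative also
    involves sin (k x); this coupling produces the double pole.  The sum equals
    that of [is_series_inv_odd_sq] because both source functions have the value
    PI / 2 at 0. *)
Lemma is_series_even_double_pole (k : nat) : Nat.Even k ->
  is_series (fun j => (odd_freq j ^ 2 + INR k ^ 2) / (odd_freq j ^ 2 - INR k ^ 2) ^ 2)
    (PI ^ 2 / 8).
Proof.
  intros hk. set (u := fun x => (PI / 2 - x) * cos (INR k * x)).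
  set (v := fun x => sin (INR k * x)).
  set (u1 := fun x => - cos (INR k * x) - (PI / 2 - x) * (INR k * sin (INR k * x))).
  assert (h1 : forall x, is_derive u x (u1 x)).
  { intros x. unfold u, u1. auto_derive; [exact I|ring]. }
  assert (h2 : forall x, is_derive u1 x (- INR k ^ 2 * u x + 2 * INR k * v x)).
  { intros x. unfold u, v, u1. auto_derive; [exact I|]. field. }
  replace (PI ^ 2 / 8) with (PI / 4 * u 0).
  2:{ unfold u. rewrite Rmult_0_r, cos_0. field. }
  apply (is_series_ext (fun j => cos_coef u (odd_freq j))).
  - intros j. pose proof (odd_freq_sq_neq_even_sq k j hk).
    assert (h : (odd_freq j ^ 2 + - INR k ^ 2) * cos_coef u (odd_freq j)
                + 2 * INR k * cos_coef v (odd_freq j) = - u1 0).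
    { apply (cos_coef_system u u1 v); auto.
      - intros x. apply continuous_sin_scaled.
      - unfold u. ring. }
    unfold v in h. rewrite cos_coef_sin_even in h by assumption.
    unfold u1 in h. rewrite Rmult_0_r, cos_0, sin_0 in h.
    apply (Rmult_eq_reg_l (odd_freq j ^ 2 - INR k ^ 2)); [|assumption].
    transitivity (1 + 2 * INR k * (INR k / (odd_freq j ^ 2 - INR k ^ 2))).
    + unfold Rdiv in *. lra.
    + field. assumption.
  - apply (is_series_cos_coef u (u1 0)).
    + exact (continuous_of_derive _ _ h1).
    + apply h1.
Qed.

(** Real and imaginary parts of sin (zeta y) and of its derivative
    zeta cos (zeta y), for the complex number zeta = s + i t. *)
Definition sin_re (s t y : R) : R := sin (s * y) * cosh (t * y).
Definition sin_im (s t y : R) : R := cos (s * y) * sinh (t * y).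
Definition dsin_re (s t y : R) : R :=
  s * (cos (s * y) * cosh (t * y)) + t * (sin (s * y) * sinh (t * y)).
Definition dsin_im (s t y : R) : R :=
  t * (cos (s * y) * cosh (t * y)) - s * (sin (s * y) * sinh (t * y)).

Lemma is_derive_sin_re (s t x : R) :
  is_derive (fun x => sin_re s t (PI / 2 - x)) x (- dsin_re s t (PI / 2 - x)).
Proof. unfold sin_re, dsin_re, cosh, sinh. auto_derive; [exact I|].
  change (PI / 2 + - x) with (PI / 2 - x). field.
Qed.

Lemma is_derive_sin_im (s t x : R) :
  is_derive (fun x => sin_im s t (PI / 2 - x)) x (- dsin_im s t (PI / 2 - x)).
Proof. unfold sin_im, dsin_im, cosh, sinh. auto_derive; [exact I|].
  change (PI / 2 + - x) with (PI / 2 - x). field.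
Qed.

(** Real and imaginary parts of the equation S'' = - zeta^2 S for
    S(x) = sin (zeta (PI / 2 - x)), where
    zeta^2 = (s^2 - t^2) + i (2 s t). *)
Lemma is_derive_dsin_re (s t x : R) :
  is_derive (fun x => - dsin_re s t (PI / 2 - x)) x
   (- (s ^ 2 - t ^ 2) * sin_re s t (PI / 2 - x) + 2 * s * t * sin_im s t (PI / 2 - x)).
Proof. unfold sin_re, sin_im, dsin_re, cosh, sinh. auto_derive; [exact I|].
  change (PI / 2 + - x) with (PI / 2 - x). field.
Qed.

Lemma is_derive_dsin_im (s t x : R) :
  is_derive (fun x => - dsin_im s t (PI / 2 - x)) x
   (- (s ^ 2 - t ^ 2) * sin_im s t (PI / 2 - x) + - (2 * s * t) * sin_re s t (PI / 2 - x)).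
Proof. unfold sin_re, sin_im, dsin_im, cosh, sinh. auto_derive; [exact I|].
  change (PI / 2 + - x) with (PI / 2 - x). field.
Qed.

Lemma is_series_lin (u v x : nat -> R) (c d lu lv l : R) :
  is_series u lu -> is_series v lv ->
  (forall j, c * u j + d * v j = x j) -> c * lu + d * lv = l ->
  is_series x l.
Proof.
  intros hu hv hx <-. apply (is_series_ext _ _ _ hx).
  exact (is_series_plus _ _ _ _ (is_series_scal c u lu hu) (is_series_scal d v lv hv)).
Qed.

(** Real and imaginary parts of (n^2 - zeta^2) c = zeta cos (zeta PI / 2), where
    c is the cosine coefficient of sin (zeta (PI / 2 - x)). *)
Lemma cos_coef_sin_system (s t : R) (j : nat) :
  let A := fun x => sin_re s t (PI / 2 - x) in
  let B := fun x => sin_im s t (PI / 2 - x) in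
  let n := odd_freq j in
  (n ^ 2 - (s ^ 2 - t ^ 2)) * cos_coef A n + 2 * s * t * cos_coef B n = dsin_re s t (PI / 2)
  /\ (n ^ 2 - (s ^ 2 - t ^ 2)) * cos_coef B n - 2 * s * t * cos_coef A n = dsin_im s t (PI / 2).
Proof.
  intros A B n.
  pose proof (continuous_of_derive _ _ (is_derive_sin_re s t)) as cA.
  pose proof (continuous_of_derive _ _ (is_derive_sin_im s t)) as cB.
  split.
  - pose proof (cos_coef_system A _ B _ _ j (is_derive_sin_re s t) (is_derive_dsin_re s t) cB) as h.
    cbv beta in h. rewrite Ropp_involutive, Rminus_0_r in h. rewrite <- h; [unfold n; ring|].
    unfold A, sin_re. rewrite Rminus_diag, !Rmult_0_r, sin_0. ring.
  - pose proof (cos_coef_system B _ A _ _ j (is_derive_sin_im s t) (is_derive_dsin_im s t) cA) as h.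
    cbv beta in h. rewrite Ropp_involutive, Rminus_0_r in h. rewrite <- h; [unfold n; ring|].
    unfold B, sin_im. rewrite Rminus_diag, !Rmult_0_r, sinh_0. ring.
Qed.

(** Real and imaginary parts of
    sum_(n odd) 1 / (n^2 - zeta^2) = PI tan (zeta PI / 2) / (4 zeta): with
    zeta^2 = a + i w, the two summands are those of 1 / (n^2 - zeta^2), and
    p + i q = zeta cos (zeta PI / 2), A0 + i B0 = sin (zeta PI / 2), whose
    quotient is rationalised by the conjugate of p + i q. *)
Lemma is_series_complex_pole (s t : R) :
  let a := s ^ 2 - t ^ 2 in
  let w := 2 * s * t in
  let p := dsin_re s t (PI / 2) in
  let q := dsin_im s t (PI / 2) in
  let A0 := sin_re s t (PI / 2) in
  let B0 := sin_im s t (PI / 2) in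
  p ^ 2 + q ^ 2 <> 0 ->
  (forall j, (odd_freq j ^ 2 - a) ^ 2 + w ^ 2 <> 0) ->
  is_series (fun j => (odd_freq j ^ 2 - a) / ((odd_freq j ^ 2 - a) ^ 2 + w ^ 2))
    (PI / 4 * ((p * A0 + q * B0) / (p ^ 2 + q ^ 2))) /\
  is_series (fun j => w / ((odd_freq j ^ 2 - a) ^ 2 + w ^ 2))
    (PI / 4 * ((p * B0 - q * A0) / (p ^ 2 + q ^ 2))).
Proof.
  intros a w p q A0 B0 hD hpole.
  set (A := fun x => sin_re s t (PI / 2 - x)).
  set (B := fun x => sin_im s t (PI / 2 - x)).
  pose proof (is_series_cos_coef A _ (continuous_of_derive _ _ (is_derive_sin_re s t))
                (is_derive_sin_re s t 0)) as sA.
  pose proof (is_series_cos_coef B _ (continuous_of_derive _ _ (is_derive_sin_im s t))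
                (is_derive_sin_im s t 0)) as sB.
  unfold A at 2 in sA. unfold B at 2 in sB. rewrite Rminus_0_r in sA, sB.
  fold A0 in sA. fold B0 in sB.
  assert (hJ : forall j, 
    let n := odd_freq j in let d := (n ^ 2 - a) ^ 2 + w ^ 2 in
    cos_coef A n = ((n ^ 2 - a) * p - w * q) / d /\ cos_coef B n = ((n ^ 2 - a) * q + w * p) / d).
  { intros j n d. destruct (cos_coef_sin_system s t j) as [h1 h2].
    fold a in h1, h2. fold w in h1, h2. fold p in h1. fold q in h2.
    fold A in h1, h2. fold B in h1, h2. rewrite <- h1, <- h2. fold n.
    pose proof (hpole j : d <> 0) as hd.
    split; apply (Rmult_eq_reg_r d); try assumption;
      unfold Rdiv; rewrite Rmult_assoc, Rinv_l, Rmult_1_r by assumption;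
      unfold d; ring. }
  split.
  - apply (is_series_lin _ _ _ (p / (p ^ 2 + q ^ 2)) (q / (p ^ 2 + q ^ 2)) _ _ _ sA sB).
    + intros j. destruct (hJ j) as [h1 h2]. rewrite h1, h2.
      field. split; [apply hpole|exact hD].
    + field. exact hD.
  - apply (is_series_lin _ _ _ (- q / (p ^ 2 + q ^ 2)) (p / (p ^ 2 + q ^ 2)) _ _ _ sA sB).
    + intros j. destruct (hJ j) as [h1 h2]. rewrite h1, h2.
      field. split; [apply hpole|exact hD].
    + field. exact hD.
Qed.

(** * Reduction of K to the partial-fraction series *)

Lemma inner_one_phi (m : nat) : (1 <= m)%nat ->
  inner (fun _ => 1) (phi m) = sqrt 2 * (1 - cos (INR m * PI)) / (INR m * PI).
Proof.
  intros hm. apply le_INR in hm. simpl in hm. pose proof PI_RGT_0 as hpi.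
  unfold inner, phi. apply is_RInt_unique.
  replace (sqrt 2 * (1 - cos (INR m * PI)) / (INR m * PI)) with
    (minus (- sqrt 2 * cos (INR m * PI * 1) / (INR m * PI))
           (- sqrt 2 * cos (INR m * PI * 0) / (INR m * PI))).
  2:{ rewrite Rmult_1_r, Rmult_0_r, cos_0. unfold minus, plus, opp; simpl. field. lra. }
  apply (is_RInt_derive (fun x => - sqrt 2 * cos (INR m * PI * x) / (INR m * PI))).
  - intros x _. auto_derive; [exact I|]. field. lra.
  - intros x _. apply (ex_derive_continuous (V := R_NormedModule)).
    auto_derive. exact I.
Qed.

Lemma inner_one_phi_even (m : nat) : (1 <= m)%nat -> Nat.Even m ->
  inner (fun _ => 1) (phi m) = 0.
Proof.
  intros hm [i ->]. rewrite inner_one_phi by assumption.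
  replace (INR (2 * i) * PI) with (0 + 2 * INR i * PI) by (rewrite mult_INR; simpl; ring).
  rewrite cos_period, cos_0. unfold Rdiv. ring.
Qed.

Lemma inner_one_phi_odd (m : nat) : Nat.Odd m ->
  inner (fun _ => 1) (phi m) / INR m = 2 * sqrt 2 / (PI * INR m ^ 2).
Proof.
  intros [i ->]. rewrite inner_one_phi by lia.
  assert (0 < INR (2 * i + 1)) by (apply lt_0_INR; lia).
  assert (h : cos (INR (2 * i + 1) * PI) = -1).
  { replace (INR (2 * i + 1) * PI) with (PI + 2 * INR i * PI)
      by (rewrite plus_INR, mult_INR; simpl; ring).
    rewrite cos_period. apply cos_PI. }
  rewrite h. field. pose proof PI_RGT_0. lra.
Qed.

Lemma absdiff_odd (n k : nat) : Nat.Odd n -> Nat.Even k -> Nat.Odd (absdiff n k).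
Proof.
  intros [j ->] [m ->]. unfold absdiff.
  destruct (le_lt_dec m j); [exists (j - m)%nat|exists (m - j - 1)%nat]; lia.
Qed.

Lemma absdiff_sq (n k : nat) : INR (absdiff n k) ^ 2 = (INR n - INR k) ^ 2.
Proof.
  unfold absdiff. rewrite INR_IZR_INZ, Zabs2Nat.id_abs, abs_IZR, minus_IZR.
  rewrite <- !INR_IZR_INZ. apply pow2_abs.
Qed.

Lemma Kterm_even (k n : nat) (omega : R) : (1 <= n)%nat -> Nat.Even n ->
  Kterm (fun _ => 1) k omega n = 0.
Proof.
  intros h1 h2. unfold Kterm. rewrite inner_one_phi_even by assumption.
  unfold Rdiv. ring.
Qed.

Lemma INR_odd_freq (j : nat) : INR (2 * j + 1) = odd_freq j.
Proof. unfold odd_freq. rewrite plus_INR, mult_INR. simpl. ring. Qed.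

Lemma Kterm_odd (k j : nat) (omega w : R) :
  Nat.Even k -> omega ^ 2 = (PI ^ 2 * w) ^ 2 ->
  let x := odd_freq j ^ 2 in
  let a := INR k ^ 2 / 2 in
  (x - a) ^ 2 + w ^ 2 <> 0 ->
  Kterm (fun _ => 1) k omega (2 * j + 1) =
  16 / PI ^ 4 * (/ x * ((x + INR k ^ 2) / (x - INR k ^ 2) ^ 2)
     * ((x - a) / ((x - a) ^ 2 + w ^ 2))).
Proof.
  intros hk hom x a hpole.
  assert (hodd : Nat.Odd (2 * j + 1)) by (exists j; reflexivity).
  pose proof PI_RGT_0 as hpi. pose proof (odd_freq_pos j) as hn.
  pose proof (pos_INR k) as hk0.
  pose proof (odd_freq_sq_neq_even_sq k j hk) as hnk.
  unfold Kterm.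
  rewrite inner_one_phi_odd by assumption.
  rewrite (inner_one_phi_odd (2 * j + 1 + k)).
  2:{ destruct hk as [m ->]. exists (j + m)%nat. lia. }
  rewrite (inner_one_phi_odd (absdiff _ _)) by now apply absdiff_odd.
  rewrite absdiff_sq.
  unfold indic_neq. destruct (Nat.eq_dec (2 * j + 1) k) as [h|_].
  { destruct hk as [m hm]. lia. }
  unfold lambda2, lambda. rewrite hom, (plus_INR _ k), !INR_odd_freq.
  assert (h2 : sqrt 2 * sqrt 2 = 2) by (apply sqrt_sqrt; lra).
  set (n := odd_freq j) in *. set (c := INR k) in *.
  assert (hm : n - c <> 0) by (intros h; apply hnk; replace n with c by lra; ring).
  assert (hres : ((n * PI) ^ 2 - (c * PI) ^ 2 / 2) /
      (((n * PI) ^ 2 - (c * PI) ^ 2 / 2) ^ 2 + (PI ^ 2 * w) ^ 2)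
      = / PI ^ 2 * ((x - a) / ((x - a) ^ 2 + w ^ 2))).
  { replace ((n * PI) ^ 2 - (c * PI) ^ 2 / 2) with (PI ^ 2 * (x - a))
      by (unfold x, a; field).
    replace ((PI ^ 2 * (x - a)) ^ 2 + (PI ^ 2 * w) ^ 2) with
      (PI ^ 4 * ((x - a) ^ 2 + w ^ 2)) by ring.
    field. split; [exact hpole|lra]. }
  rewrite hres. set (e := (x - a) / _).
  transitivity (sqrt 2 * sqrt 2 * (4 / PI ^ 4 * (/ n ^ 2 * (/ (n + c) ^ 2 + / (n - c) ^ 2))
    * e)).
  - field. lra.
  - rewrite h2. unfold x in *. field. repeat split; try lra.
Qed.

Lemma is_series_even_terms (f : nat -> R) (l : R) :
  (forall j, f (2 * j + 1)%nat = 0) ->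
  is_series (fun j => f (2 * j)%nat) l -> is_series f l.
Proof.
  intros h0 hs. assert (hp : is_pseries f 1 l).
  2:{ apply is_pseries_R in hp. refine (is_series_ext _ _ _ _ hp).
      intros n. rewrite pow1. apply Rmult_1_r. }
  replace l with (l + 1 * 0) by ring.
  apply is_pseries_odd_even; apply is_pseries_R.
  - apply (is_series_ext (fun j => f (2 * j)%nat)); [|exact hs].
    intros n. rewrite !pow1. symmetry. apply Rmult_1_r.
  - apply (is_series_lin _ _ _ 0 0 _ _ _ hs hs); [|ring].
    intros n. rewrite h0. ring.
Qed.

(** Partial fractions in x = n^2.  With z = a + i w and k^2 = 2 a, the rational
    function (x + 2 a) / (x (x - 2 a)^2 (x - z)) has the coefficients
    -1 / (2 a z) at 1 / x and 1 / (2 a (2 a - z)) at (x + 2 a) / (x - 2 a)^2.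
    Since 2 a - z is the conjugate of z, their real parts are -1 / (2 |z|^2)
    and 1 / (2 |z|^2), and the two equal sums PI^2 / 8 cancel.  The pole
    1 / (x - 2 a) sums to 0, and only the pole at z contributes, with residue
    M = (z + 2 a) z / |z|^4 = (3 a^2 - w^2 + 4 a w i) / |z|^4. *)
Lemma K_from_pole_sums (k : nat) (omega w T1 T2 : R) :
  (1 <= k)%nat -> Nat.Even k -> omega ^ 2 = (PI ^ 2 * w) ^ 2 ->
  let a := INR k ^ 2 / 2 in
  (forall j, (odd_freq j ^ 2 - a) ^ 2 + w ^ 2 <> 0) ->
  is_series (fun j => (odd_freq j ^ 2 - a) / ((odd_freq j ^ 2 - a) ^ 2 + w ^ 2)) T1 ->
  is_series (fun j => w / ((odd_freq j ^ 2 - a) ^ 2 + w ^ 2)) T2 ->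
  K (fun _ => 1) k omega =
  16 / PI ^ 4 * (((3 * a ^ 2 - w ^ 2) * T1 - 4 * a * w * T2) / (a ^ 2 + w ^ 2) ^ 2).
Proof.
  intros hk1 hk hom a hpole s1 s2.
  assert (hkR : 1 <= INR k) by now apply (le_INR 1).
  assert (hz : 0 < a ^ 2 + w ^ 2) by (assert (0 < a) by (unfold a; nra); nra).
  unfold K. apply is_series_unique. apply is_series_even_terms.
  { intros j. apply Kterm_even; [lia|]. exists (j + 1)%nat. lia. }
  (* r1: the two series that cancel; r2: adds the simple pole at 2 a; r3: the
     real part of M / (n^2 - z). *)
  pose proof (is_series_lin _ _ _ (- / (2 * (a ^ 2 + w ^ 2))) (/ (2 * (a ^ 2 + w ^ 2))) _ _ _
    is_series_inv_odd_sq (is_series_even_double_pole k hk)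
    (fun j => eq_refl) eq_refl) as r1.
  pose proof (is_series_lin _ _ _ 1 (- ((3 * a ^ 2 - w ^ 2) / (a ^ 2 + w ^ 2) ^ 2)) _ _ _
    r1 (is_series_even_pole k hk hk1) (fun j => eq_refl) eq_refl) as r2.
  pose proof (is_series_lin _ _ _ ((3 * a ^ 2 - w ^ 2) / (a ^ 2 + w ^ 2) ^ 2)
    (- (4 * a * w) / (a ^ 2 + w ^ 2) ^ 2) _ _ _
    s1 s2 (fun j => eq_refl) eq_refl) as r3.
  apply (is_series_lin _ _ _ (16 / PI ^ 4) (16 / PI ^ 4) _ _ _ r2 r3).
  - intros j. pose proof (Kterm_odd k j omega w hk hom (hpole j)) as hK.
    replace (S (2 * j)) with (2 * j + 1)%nat by lia. rewrite hK.
    rewrite <- Rmult_plus_distr_l. f_equal.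
    pose proof (odd_freq_pos j) as hn.
    pose proof (odd_freq_sq_neq_even_sq k j hk) as hnk.
    assert (hx : odd_freq j ^ 2 <> 0) by nra.
    pose proof (hpole j) as hp.
    set (x := odd_freq j ^ 2) in *. fold a.
    replace (INR k ^ 2) with (2 * a) in * by (unfold a; field).
    clearbody x a. field. repeat split; lra.
  - field. pose proof PI_RGT_0. lra.
Qed.

(** * The sign of K *)

Lemma cosh_sq (x : R) : cosh x ^ 2 = 1 + sinh x ^ 2.
Proof.
  unfold cosh, sinh. assert (h : exp x * exp (- x) = 1).
  { rewrite <- exp_plus, Rplus_opp_r. apply exp_0. }
  nra.
Qed.

Lemma sinh_ge (x : R) : 0 <= x -> x <= sinh x.
Proof.
  intros hx. destruct (MVT_gen sinh 0 x cosh) as [c [_ hc]].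
  - intros y _. apply is_derive_Reals, derivable_pt_lim_sinh.
  - intros y _. apply derivable_continuous_pt. exists (cosh y). apply derivable_pt_lim_sinh.
  - rewrite sinh_0 in hc.
    assert (1 <= cosh c).
    { unfold cosh. pose proof (exp_ineq1_le c). pose proof (exp_ineq1_le (- c)). lra. }
    nra.
Qed.

(** With zeta = s + i t and zeta^2 = a + i w this is, up to a positive factor,
    the real part of (zeta^2 + 2 a) zeta tan (zeta PI / 2): clearing the
    denominator |cos (zeta PI / 2)|^2 leaves sin cos for the real and sinh cosh
    for the imaginary part of the tangent. *)
Definition sign_factor (s t : R) : R :=
  (3 * s ^ 2 - 5 * t ^ 2) * s * (sin (s * (PI / 2)) * cos (s * (PI / 2)))
  - (5 * s ^ 2 - 3 * t ^ 2) * t * (sinh (t * (PI / 2)) * cosh (t * (PI / 2))).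

(** |zeta cos (zeta PI / 2)|^2 = |zeta|^2 |cos (zeta PI / 2)|^2. *)
Lemma dsin_norm (s t : R) :
  dsin_re s t (PI / 2) ^ 2 + dsin_im s t (PI / 2) ^ 2 =
  (s ^ 2 + t ^ 2) * (cos (s * (PI / 2)) ^ 2 + sinh (t * (PI / 2)) ^ 2).
Proof.
  unfold dsin_re, dsin_im.
  pose proof (sin2_cos2 (s * (PI / 2))) as h. unfold Rsqr in h.
  pose proof (cosh_sq (t * (PI / 2))) as h'.
  set (S := sin (s * (PI / 2))) in *. set (C := cos (s * (PI / 2))) in *.
  set (Sh := sinh (t * (PI / 2))) in *. set (Ch := cosh (t * (PI / 2))) in *.
  assert (hS : S ^ 2 = 1 - C ^ 2) by (simpl; lra).
  transitivity ((s ^ 2 + t ^ 2) * (C ^ 2 * Ch ^ 2 + S ^ 2 * Sh ^ 2)); [ring|].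
  rewrite h', hS. ring.
Qed.

(** The factor is positive because cos (zeta PI / 2) <> 0: a zero would make
    zeta an odd integer with zeta^2 = k^2 / 2, which is even when [k] is.
    For the same reason no term of the series has a pole. *)
Lemma K_eq_pos_mult_sign_factor (k : nat) (omega s t : R) :
  (1 <= k)%nat -> Nat.Even k -> 0 <= s -> 0 <= t ->
  s ^ 2 - t ^ 2 = INR k ^ 2 / 2 -> omega ^ 2 = (PI ^ 2 * (2 * s * t)) ^ 2 ->
  exists c, 0 < c /\ K (fun _ => 1) k omega = c * sign_factor s t.
Proof.
  intros hk1 hk hs ht ha hom. pose proof PI_RGT_0 as hpi.
  assert (hkR : 1 <= INR k) by now apply (le_INR 1).
  assert (hst : 0 < s ^ 2 + t ^ 2) by nra.
  assert (hpole : forall j, (odd_freq j ^ 2 - (s ^ 2 - t ^ 2)) ^ 2 + (2 * s * t) ^ 2 <> 0).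
  { intros j h. rewrite ha in h.
    assert (h0 : odd_freq j ^ 2 - INR k ^ 2 / 2 = 0) by nra.
    destruct hk as [m ->]. unfold odd_freq in h0. rewrite mult_INR, !INR_IZR_INZ in h0.
    set (i := Z.of_nat j) in h0. set (p := Z.of_nat m) in h0.
    (* With n = 2 i + 1 and k = 2 p, n^2 = k^2 / 2 = 2 p^2 equates an odd and an
       even integer. *)
    assert (hz : IZR (4 * (i * i + i) - 2 * (p * p)) = IZR (-1)).
    { rewrite minus_IZR, !mult_IZR, plus_IZR, !mult_IZR. simpl in h0 |- *. lra. }
    apply eq_IZR in hz. lia. }
  pose proof (dsin_norm s t) as hD.
  assert (hE : 0 < cos (s * (PI / 2)) ^ 2 + sinh (t * (PI / 2)) ^ 2).
  { destruct (Req_dec t 0) as [->|ht0].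
    - rewrite Rmult_0_l, sinh_0.
      rewrite pow_ne_zero, Rplus_0_r by discriminate.
      apply pow2_gt_0. intros hc. apply cos_eq_0_0 in hc. destruct hc as [z hz].
      assert (hs' : s = 2 * IZR z + 1).
      { apply (Rmult_eq_reg_r (PI / 2)); lra. }
      assert (hz0 : (0 <= z)%Z).
      { apply Z.lt_succ_r. unfold Z.succ. apply lt_IZR. rewrite plus_IZR. lra. }
      apply (hpole (Z.to_nat z)). unfold odd_freq.
      rewrite INR_IZR_INZ, Z2Nat.id by assumption. rewrite <- hs'. ring.
    - pose proof (sinh_ge (t * (PI / 2)) ltac:(nra)).
      assert (0 < t * (PI / 2)) by (apply Rmult_lt_0_compat; lra). nra. }
  assert (hD0 : 0 < dsin_re s t (PI / 2) ^ 2 + dsin_im s t (PI / 2) ^ 2)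
    by (rewrite hD; now apply Rmult_lt_0_compat).
  destruct (is_series_complex_pole s t (Rgt_not_eq _ _ hD0) hpole) as [s1 s2].
  rewrite ha in s1, s2, hpole.
  pose proof (K_from_pole_sums k omega _ _ _ hk1 hk hom hpole s1 s2) as hK.
  rewrite <- ha in hK. rewrite hD in hK, hD0.
  set (E := cos (s * (PI / 2)) ^ 2 + sinh (t * (PI / 2)) ^ 2) in *.
  exists (4 / (PI ^ 3 * E * (s ^ 2 + t ^ 2) ^ 4)). split.
  { apply Rdiv_lt_0_compat; [lra|].
    apply Rmult_lt_0_compat; [|now apply pow_lt].
    apply Rmult_lt_0_compat; [now apply pow_lt|exact hE]. }
  rewrite hK. unfold sign_factor.
  set (X := sin (s * (PI / 2)) * cos (s * (PI / 2))).
  set (Y := sinh (t * (PI / 2)) * cosh (t * (PI / 2))).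
  pose proof (sin2_cos2 (s * (PI / 2))) as h. unfold Rsqr in h.
  pose proof (cosh_sq (t * (PI / 2))) as h'.
  assert (e1 : dsin_re s t (PI / 2) * sin_re s t (PI / 2)
              + dsin_im s t (PI / 2) * sin_im s t (PI / 2) = s * X + t * Y).
  { unfold dsin_re, dsin_im, sin_re, sin_im, X, Y.
    set (S := sin (s * (PI / 2))) in *. set (C := cos (s * (PI / 2))) in *.
    set (Sh := sinh (t * (PI / 2))) in *. set (Ch := cosh (t * (PI / 2))) in *.
    transitivity (s * (S * C) * (Ch ^ 2 - Sh ^ 2) + t * (Sh * Ch) * (S * S + C * C));
      [ring|]. rewrite h, h'. ring. }
  assert (e2 : dsin_re s t (PI / 2) * sin_im s t (PI / 2)
              - dsin_im s t (PI / 2) * sin_re s t (PI / 2) = s * Y - t * X).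
  { unfold dsin_re, dsin_im, sin_re, sin_im, X, Y.
    set (S := sin (s * (PI / 2))) in *. set (C := cos (s * (PI / 2))) in *.
    set (Sh := sinh (t * (PI / 2))) in *. set (Ch := cosh (t * (PI / 2))) in *.
    transitivity (s * (Sh * Ch) * (S * S + C * C) - t * (S * C) * (Ch ^ 2 - Sh ^ 2));
      [ring|]. rewrite h, h'. ring. }
  rewrite e1, e2.
  replace ((s ^ 2 - t ^ 2) ^ 2 + (2 * s * t) ^ 2) with ((s ^ 2 + t ^ 2) ^ 2) by ring.
  field. lra.
Qed.

Lemma sign_factor_double_angle (s t : R) :
  2 * sign_factor s t = (3 * s ^ 2 - 5 * t ^ 2) * (s * sin (PI * s))
    - (5 * s ^ 2 - 3 * t ^ 2) * (t * (2 * (sinh (t * (PI / 2)) * cosh (t * (PI / 2))))).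
Proof.
  replace (PI * s) with (2 * (s * (PI / 2))) by field.
  rewrite sin_2a. unfold sign_factor. ring.
Qed.

Lemma sin_growth (x y : R) : x <= y -> sin y <= sin x + (y - x).
Proof.
  intros hxy. destruct (MVT_gen sin x y cos) as [c [_ hc]].
  - intros z _. apply is_derive_Reals, derivable_pt_lim_sin.
  - intros z _. apply continuity_sin.
  - pose proof (COS_bound c). nra.
Qed.

(** Negativity at t = 0 propagates along the hyperbola s^2 - t^2 = b^2.  On the
    part where 3 s^2 >= 5 t^2, moving from b to s raises sin (PI s) by at most
    PI (s - b) <= PI t^2 / s, which the second term outweighs already by
    sinh (PI t) >= PI t.  On the other part t^2 > 3, and the same bound
    for sinh outweighs |sin| <= 1. *)
Lemma sign_factor_neg (b s t : R) :
  0 <= b -> 2 <= b ^ 2 -> sin (PI * b) < 0 -> 0 <= s -> 0 <= t -> s ^ 2 - t ^ 2 = b ^ 2 ->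
  sign_factor s t < 0.
Proof.
  intros hb hb2 hsin hs ht hst. pose proof PI_RGT_0 as hpi.
  assert (hpi1 : 1 < PI) by (pose proof PI2_3_2; unfold PI2 in *; lra).
  assert (hs0 : 0 < s) by nra.
  assert (hbs : b <= s) by nra.
  assert (hts : t <= s) by nra.
  assert (hY : PI * t <= 2 * (sinh (t * (PI / 2)) * cosh (t * (PI / 2)))).
  { assert (h0 : 0 <= t * (PI / 2)) by nra.
    pose proof (sinh_ge _ h0) as h1. pose proof (cosh_sq (t * (PI / 2))) as h2.
    assert (h3 : 0 < cosh (t * (PI / 2))).
    { unfold cosh. pose proof (exp_pos (t * (PI / 2))).
      pose proof (exp_pos (- (t * (PI / 2)))). lra. }
    nra. }
  pose proof (sign_factor_double_angle s t) as h2.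
  set (Y := 2 * (sinh (t * (PI / 2)) * cosh (t * (PI / 2)))) in *.
  assert (htY : PI * t ^ 2 <= t * Y) by nra.
  assert (hR : (5 * s ^ 2 - 3 * t ^ 2) * (PI * t ^ 2) <= (5 * s ^ 2 - 3 * t ^ 2) * (t * Y)).
  { apply Rmult_le_compat_l; [nra|exact htY]. }
  assert (hPt : 0 <= PI * t ^ 2) by nra.
  destruct (Rle_lt_dec (5 * t ^ 2) (3 * s ^ 2)) as [hc|hc].
  - assert (hg : s * sin (PI * s) <= s * sin (PI * b) + PI * t ^ 2).
    { pose proof (sin_growth (PI * b) (PI * s) ltac:(nra)) as hg.
      assert (hsb : s * (s - b) <= t ^ 2) by nra.
      assert (s * sin (PI * s) <= s * (sin (PI * b) + (PI * s - PI * b)))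
        by (apply Rmult_le_compat_l; lra).
      nra. }
    assert (hL : (3 * s ^ 2 - 5 * t ^ 2) * (s * sin (PI * s)) <=
      (3 * s ^ 2 - 5 * t ^ 2) * (s * sin (PI * b) + PI * t ^ 2))
      by (apply Rmult_le_compat_l; lra).
    assert (hneg : s * sin (PI * b) < 0) by nra.
    destruct (Req_dec (3 * s ^ 2) (5 * t ^ 2)) as [he|he].
    + assert (ht2 : 0 < t ^ 2) by nra.
      assert (0 < (2 * s ^ 2 + 2 * t ^ 2) * (PI * t ^ 2)) by nra.
      nra.
    + assert ((3 * s ^ 2 - 5 * t ^ 2) * (s * sin (PI * b)) < 0) by nra.
      assert (0 <= (2 * s ^ 2 + 2 * t ^ 2) * (PI * t ^ 2)) by nra.
      nra.
  - assert (ht3 : 3 < t ^ 2) by nra.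
    assert (hst2 : s < t ^ 2).
    { assert (s ^ 2 < (t ^ 2) ^ 2) by nra. nra. }
    pose proof (SIN_bound (PI * s)) as hb1.
    assert (hL : (3 * s ^ 2 - 5 * t ^ 2) * (s * sin (PI * s)) <= (5 * t ^ 2 - 3 * s ^ 2) * s).
    { replace ((3 * s ^ 2 - 5 * t ^ 2) * (s * sin (PI * s))) with
        ((5 * t ^ 2 - 3 * s ^ 2) * (s * - sin (PI * s))) by ring.
      apply Rmult_le_compat_l; [lra|]. nra. }
    assert (h3 : (5 * t ^ 2 - 3 * s ^ 2) * s < (5 * t ^ 2 - 3 * s ^ 2) * t ^ 2)
      by (apply Rmult_lt_compat_l; lra).
    assert (h4 : (5 * t ^ 2 - 3 * s ^ 2) * t ^ 2 <= (5 * s ^ 2 - 3 * t ^ 2) * t ^ 2)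
      by (apply Rmult_le_compat_r; nra).
    assert (h5 : (5 * s ^ 2 - 3 * t ^ 2) * t ^ 2 <= (5 * s ^ 2 - 3 * t ^ 2) * (PI * t ^ 2))
      by (apply Rmult_le_compat_l; nra).
    lra.
Qed.

Lemma sin_neg_iff (b : R) : 0 <= b ->
  sin (PI * b) < 0 <-> exists m : Z, 1 + 2 * IZR m < b < 2 + 2 * IZR m.
Proof.
  intros hb. pose proof PI_RGT_0 as hpi.
  assert (hper : forall m : Z, (0 <= m)%Z -> sin (PI * b) = sin (PI * (b - 2 * IZR m))).
  { intros m hm. rewrite <- (sin_period (PI * (b - 2 * IZR m)) (Z.to_nat m)).
    rewrite INR_IZR_INZ, Z2Nat.id by exact hm. f_equal. ring. }
  split.
  - intros h. destruct (archimed (b / 2)) as [h1 h2].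
    set (m := (up (b / 2) - 1)%Z).
    assert (hm : IZR m = IZR (up (b / 2)) - 1) by (unfold m; now rewrite minus_IZR).
    assert (hm0 : (0 <= m)%Z).
    { apply Z.lt_succ_r. unfold Z.succ. apply lt_IZR. rewrite plus_IZR. lra. }
    exists m. rewrite (hper m hm0) in h. split; [|lra].
    apply Rnot_le_lt. intros hle. apply (Rlt_not_le _ _ h).
    apply sin_ge_0; nra.
  - intros [m [h1 h2]].
    assert (hm0 : (0 <= m)%Z).
    { apply Z.lt_succ_r. unfold Z.succ. apply lt_IZR. rewrite plus_IZR. lra. }
    rewrite (hper m hm0). apply sin_lt_0; nra.
Qed.

Theorem proposition3p9 (k : nat) (hk : (1 <= k)%nat) (hkeven : Nat.Even k) :
  (forall omega : R, K (fun _ => 1) k omega < 0) <->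
  (exists m : Z,
      sqrt 2 + 2 * sqrt 2 * IZR m < INR k < 2 * sqrt 2 + 2 * sqrt 2 * IZR m).
Proof.
  assert (hk2 : 2 <= INR k).
  { apply (le_INR 2). destruct hkeven. lia. }
  assert (hq : 0 < sqrt 2) by (apply sqrt_lt_R0; lra).
  assert (hqq : sqrt 2 ^ 2 = 2) by (apply pow2_sqrt; lra).
  pose proof PI_RGT_0 as hpi.
  set (b := INR k / sqrt 2).
  assert (hkb : INR k = sqrt 2 * b) by (unfold b; field; lra).
  assert (hb : 0 <= b) by (apply Rlt_le, Rdiv_lt_0_compat; lra).
  assert (hb2 : b ^ 2 = INR k ^ 2 / 2).
  { rewrite hkb, Rpow_mult_distr, hqq. field. }
  transitivity (sin (PI * b) < 0).
  - split.
    + intros hneg.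
      (* At omega = 0 the sign of K is that of sin (PI b). *)
      destruct (K_eq_pos_mult_sign_factor k 0 b 0 hk hkeven hb (Rle_refl 0)) as [c [hc hK]];
        [rewrite <- hb2; ring|ring|].
      specialize (hneg 0). rewrite hK in hneg.
      pose proof (sign_factor_double_angle b 0) as h2.
      assert (hs : sign_factor b 0 < 0) by nra.
      assert (h3 : 3 * b ^ 2 * b * sin (PI * b) < 0) by lra.
      apply Rnot_le_lt. intros hle. apply (Rlt_not_le _ _ h3).
      apply Rmult_le_pos; [|exact hle]. apply Rmult_le_pos; nra.
    + intros hsin omega.
      set (a := b ^ 2) in *.
      assert (ha : 2 <= a) by nra.
      (* s + i t is the square root of a + i |omega| / PI^2, and z is the modulus
         of the latter. *)
      set (z := sqrt (a ^ 2 + (omega / PI ^ 2) ^ 2)).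
      assert (hz2 : z ^ 2 = a ^ 2 + (omega / PI ^ 2) ^ 2) by (apply pow2_sqrt; nra).
      assert (hz0 : 0 <= z) by apply sqrt_pos.
      assert (hza : a <= z) by nra.
      set (s := sqrt ((z + a) / 2)). set (t := sqrt ((z - a) / 2)).
      assert (hs2 : s ^ 2 = (z + a) / 2) by (apply pow2_sqrt; lra).
      assert (ht2 : t ^ 2 = (z - a) / 2) by (apply pow2_sqrt; lra).
      assert (hs0 : 0 <= s) by apply sqrt_pos.
      assert (ht0 : 0 <= t) by apply sqrt_pos.
      destruct (K_eq_pos_mult_sign_factor k omega s t hk hkeven hs0 ht0) as [c [hc hK]].
      * lra.
      * replace ((PI ^ 2 * (2 * s * t)) ^ 2) with (PI ^ 4 * (4 * (s ^ 2 * t ^ 2))) by ring.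
        rewrite hs2, ht2.
        replace (4 * ((z + a) / 2 * ((z - a) / 2))) with (z ^ 2 - a ^ 2) by field.
        rewrite hz2. field. lra.
      * rewrite hK.
        assert (sign_factor s t < 0) by (apply (sign_factor_neg b); try assumption; fold a; lra).
        nra.
  - rewrite (sin_neg_iff b hb), hkb.
    assert (hcmp : forall x y : R, sqrt 2 * x < sqrt 2 * y <-> x < y).
    { intros x y. split; intros h; [apply (Rmult_lt_reg_l (sqrt 2))|
        apply Rmult_lt_compat_l]; assumption. }
    split; intros [m [h1 h2]]; exists m.
    + split; [replace (sqrt 2 + _) with (sqrt 2 * (1 + 2 * IZR m)) by ring
             |replace (2 * sqrt 2 + _) with (sqrt 2 * (2 + 2 * IZR m)) by ring];
        now apply hcmp.
    + split; apply hcmp; lra.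
Qed.
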